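(* Let $\pi\colon(P,k)\to(M,g)$ be a smooth submersion of Riemannian manifolds. If $V,W$ are vertical and $H,K$ are horizontal vector fields on $P$, then: (i) $\Theta(V,W)=0$; (ii) $\Theta(V,H)=-\mathcal A_HV$; (iii) $\Theta(H,K)=-\vartheta^v[H,K]$. Thus $\pi$ is flat if and only if $\pi$ has totally geodesic fibres and integrable horizontal distribution.
   Context: Write $TP=\mathcal V\oplus\mathcal H$ with $\mathcal V=\ker d\pi$ (vertical) and $\mathcal H=\mathcal V^\perp$ (horizontal), and let $\vartheta^v\colon TP\to\mathcal V$ be the orthogonal projection. Let $\nabla$ be the Levi-Civita connection of $(P,k)$ and $\nabla^v=\vartheta^v\circ\nabla$ the induced connection in $\mathcal V\to P$. The curvature form of $\pi$ is the $\mathcal V$-valued $2$-form $\Theta=d^v\vartheta^v$ on $P$, where $d^v$ is the exterior derivative on $\mathcal V$-valued forms determined by $\nabla^v$, i.e. $\Theta(A,B)=\nabla^v_A(\vartheta^vB)-\nabla^v_B(\vartheta^vA)-\vartheta^v[A,B]$ for vector fields $A,B$ on $P$; $\pi$ is flat if $\Theta=0$. The collective shape operator $\mathcal A$ of the fibres of $\pi$ is defined by $\mathcal A_HV=-\vartheta^v(\nabla_VH)$ for all vertical (resp. horizontal) vector fields $V$ (resp. $H$) on $P$.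
   Formalization: The sign in (ii) is corrected to Θ(V,H) = A_H V (equivalently Θ(H,V) = −A_H V), since with the given definitions the printed formula fails, e.g. for r: R²∖0 → R_{>0} with V = ∂_θ, H = ∂_r. *)

(* Defs.v *)
From HB Require Import structures.
From mathcomp Require Import all_boot all_order all_algebra.
From mathcomp Require Import mathcomp_extra boolp classical_sets functions.
From mathcomp Require Import cardinality reals topology normedtype landau derive.
From mathcomp Require Import ring.

Set Implicit Arguments.
Unset Strict Implicit.
Unset Printing Implicit Defensive.

Import Order.TTheory GRing.Theory Num.Theory.
Import numFieldNormedType.Exports.

Local Open Scope classical_set_scope.
Local Open Scope ring_scope.

Section Smooth.
Context {R : realType}.

(* On an open set U this is the usual C^k: f is differentiable on U and all its
   directional derivatives are C^(k-1). Values of f outside U are irrelevant. *)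
Fixpoint Ck n (k : nat) (U : set 'rV[R]_n) (f : 'rV[R]_n -> R) : Prop :=
  match k with
  | 0 => forall x, U x -> {for x, continuous f}
  | j.+1 => (forall x, U x -> differentiable f x) /\
            (forall v, Ck j U (fun x => 'D_v f x))
  end.

Definition smooth_on n (U : set 'rV[R]_n) (f : 'rV[R]_n -> R) : Prop :=
  forall k, Ck k U f.

Definition smooth_map_on n m (U : set 'rV[R]_n) (phi : 'rV[R]_n -> 'rV[R]_m) :=
  forall j, smooth_on U (fun x => phi x 0 j).

Lemma near_eq_differentiable (V W : normedModType R) (f g : V -> W) x :
  {near x, f =1 g} -> differentiable f x -> differentiable g x.
Proof.
move=> fg df; have -> : g = f + (g - f) by rewrite addrC subrK.
apply: differentiableD => //.
set z := g - f.
have zx : \forall y \near x, z y = 0.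
  by near=> y; rewrite /z !fctE (near fg y _)// subrr.
have z0 : z x = 0 by apply: (nbhs_singleton zx).
have E : z \o shift x = cst (z x) + (\0 : V -> W) +o_ (0 : V) id.
  rewrite z0; apply/eqaddoP => e e0.
  have : \forall h \near (0 : V), z (h + x) = 0.
    by move: zx; rewrite (near_shift 0 x); apply: filterS => h /=; rewrite subr0.
  apply: filterS => h /= hz.
  by rewrite !fctE /= hz !addr0 subr0 normr0 mulr_ge0 // ltW.
apply/diff_locallyP.
have d0 : 'd z x = (\0 : V -> W) :> (V -> W).
  by apply: diff_unique => //; exact: cst_continuous.
split; last by rewrite d0.
by rewrite d0; exact: cst_continuous.
Unshelve. all: by end_near. Qed.

Lemma Ck_eq n k (U : set 'rV[R]_n) f g : open U ->
  (forall x, U x -> f x = g x) -> Ck k U f -> Ck k U g.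
Proof.
move=> oU; elim: k f g => [|k IH] f g fg /=.
  move=> cf x Ux.
  have nfg : {near x, f =1 g} by apply: filterS (open_nbhs_nbhs (conj oU Ux)).
  rewrite /prop_for /continuous_at -(fg x Ux); apply: cvg_trans (cf x Ux).
  exact: (near_eq_cvg nfg).
case=> df cf; split.
  move=> x Ux; apply: near_eq_differentiable (df x Ux).
  by apply: filterS (open_nbhs_nbhs (conj oU Ux)).
move=> v; apply: IH (cf v) => x Ux; apply: near_eq_derive.
by apply: filterS (open_nbhs_nbhs (conj oU Ux)).
Qed.

Lemma CkW n k (U : set 'rV[R]_n) f : Ck k.+1 U f -> Ck k U f.
Proof.
elim: k f => [|k IH] f [df cf]; first by move=> x Ux; apply/differentiable_continuous/df.
by split => // v; apply/IH/cf.
Qed.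

Lemma Ck_sub n k (U V : set 'rV[R]_n) f : V `<=` U -> Ck k U f -> Ck k V f.
Proof.
move=> VU; elim: k f => [|k IH] f /=; first by move=> cf x /VU /cf.
by case=> df cf; split=> [x /VU /df//|v]; exact/IH/cf.
Qed.

Lemma Ck_local n k (U : set 'rV[R]_n) f :
  (forall x, U x -> exists2 V, V x & Ck k V f) -> Ck k U f.
Proof.
elim: k f => [|k IH] f H /=; first by move=> x /H [V Vx /(_ x Vx)].
split=> [x /H [V Vx [/(_ x Vx)]]//|v].
by apply: IH => x /H [V Vx [_ /(_ v)]]; exists V.
Qed.

Lemma Ck_cst n k (U : set 'rV[R]_n) (c : R) : Ck k U (fun _ => c).
Proof.
elim: k c => [|k IH] c /=; first by move=> x _; exact: cst_continuous.
split=> [x _|v]; first exact: differentiable_cst.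
rewrite (_ : 'D_v _ = (fun=> 0)) ?funeqE // => x.
exact: derive_cst.
Qed.

Lemma CkD n k (U : set 'rV[R]_n) f g : open U ->
  Ck k U f -> Ck k U g -> Ck k U (fun x => f x + g x).
Proof.
move=> oU; elim: k f g => [|k IH] f g /=.
  by move=> cf cg x Ux; apply: continuousD; [exact: cf|exact: cg].
move=> [df cf] [dg cg]; split=> [x Ux|v].
  by apply: differentiableD; [exact: df|exact: dg].
apply: Ck_eq (IH _ _ (cf v) (cg v)) => // x Ux.
by rewrite deriveD //; apply/diff_derivable; [exact: df|exact: dg].
Qed.

Lemma CkM n k (U : set 'rV[R]_n) f g : open U ->
  Ck k U f -> Ck k U g -> Ck k U (fun x => f x * g x).
Proof.
move=> oU; elim: k f g => [|k IH] f g.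
  by move=> cf cg x Ux; apply: continuousM; [exact: cf|exact: cg].
move=> Cf Cg; have [df cf] := Cf; have [dg cg] := Cg; split=> [x Ux|v].
  by apply: differentiableM; [exact: df|exact: dg].
apply: Ck_eq (CkD oU (IH _ _ (CkW Cf) (cg v)) (IH _ _ (CkW Cg) (cf v))) => // x Ux.
by rewrite deriveM //; apply/diff_derivable; [exact: df|exact: dg].
Qed.

Lemma Ck_sum n k (U : set 'rV[R]_n) (I : Type) (r : seq I) (F : I -> 'rV[R]_n -> R) :
  open U -> (forall i, Ck k U (F i)) -> Ck k U (fun x => \sum_(i <- r) F i x).
Proof.
move=> oU CF; elim: r => [|i r IH].
  apply: Ck_eq (Ck_cst k U 0) => // x _; by rewrite big_nil.
by apply: Ck_eq (CkD oU (CF i) IH) => // x _; rewrite big_cons.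
Qed.

Lemma differentiable_coords n m (phi : 'rV[R]_n -> 'rV[R]_m) x :
  (forall j, differentiable (fun y => phi y 0 j) x) -> differentiable phi x.
Proof.
move=> H; have -> : phi = \sum_j (fun y => phi y 0 j *: delta_mx 0 j).
  by apply/funext => y; rewrite fct_sumE -row_sum_delta.
by apply: differentiable_sum => j; exact: differentiableZl.
Qed.

Lemma Ck_comp n m k (U : set 'rV[R]_n) (W : set 'rV[R]_m) f phi :
  open U -> (forall x, U x -> W (phi x)) ->
  (forall j, Ck k U (fun x => phi x 0 j)) -> Ck k W f ->
  Ck k U (fun x => f (phi x)).
Proof.
move=> oU UW; elim: k f => [|k IH] f.
  move=> /= cphi cf x Ux; apply: (@continuous_comp _ _ _ phi f); last exact/cf/UW.
  have -> : phi = fun y => \sum_j phi y 0 j *: delta_mx 0 j.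
    by apply/funext => y; exact: row_sum_delta.
  apply: (@cvg_big _ _ _ _ predT) => [||j _]; [exact: add_continuous|exact: nbhs_filter|].
  apply: cvgZr_tmp; [exact: nbhs_filter|exact: (cphi j x Ux)].
move=> Cphi Cf; have [df cf] := Cf.
have dphi x : U x -> differentiable phi x.
  by move=> Ux; apply: differentiable_coords => j; have [/(_ x Ux)] := Cphi j.
split=> [x Ux|v].
  exact: (differentiable_comp (dphi _ Ux) (df _ (UW _ Ux))).
have CS : Ck k U (fun x => \sum_j 'D_v (fun y => phi y 0 j) x *
                                'D_(delta_mx 0 j) f (phi x)).
  apply: Ck_sum => // j; apply: CkM => //; first by have [_ /(_ v)] := Cphi j.
  by apply: IH (cf _) => i; exact: CkW.
apply: Ck_eq CS => // x Ux.
rewrite (deriveE v (differentiable_comp (dphi _ Ux) (df _ (UW _ Ux)))).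
rewrite diff_comp //=; [|exact: dphi|exact/df/UW].
rewrite -(deriveE v (dphi x Ux)) [X in 'd f _ X]row_sum_delta linear_sum.
apply: eq_bigr => j _; rewrite linearZ /= (deriveE _ (df _ (UW _ Ux))); congr (_ * _).
rewrite derive_mx ?mxE //.
exact/diff_derivable/dphi.
Qed.
End Smooth.

Section Manifold.
Context {R : realType}.

(* [icoord] is total, but only its values on [codom] are meaningful. *)
Record chart (T : topologicalType) (n : nat) := Chart {
  dom : set T;
  coord : T -> 'rV[R]_n;
  icoord : 'rV[R]_n -> T;
  dom_open : open dom;
  codom_open : open (coord @` dom);
  coordK : {in dom, cancel coord icoord};
  coord_continuous : {in dom, continuous coord};
  icoord_continuous : {in coord @` dom, continuous icoord} }.

Definition codom T n (c : chart T n) : set 'rV[R]_n := coord c @` dom c.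

Record manifold (n : nat) := Manifold {
  carrier :> topologicalType;
  carrier_hausdorff : hausdorff_space carrier;
  carrier_countable : @second_countable carrier;
  atlas : set (chart carrier n);
  atlas_cover : forall p, exists2 c, atlas c & dom c p;
  atlas_compat : forall c c', atlas c -> atlas c' ->
    smooth_map_on (coord c @` (dom c `&` dom c')) (coord c' \o icoord c) }.

(* The codomain is R^o so that functions on M form a module over R. *)
Definition smooth_fun n (M : manifold n) (f : M -> R^o) : Prop :=
  forall c, atlas c -> smooth_on (codom c) (f \o icoord c).

Definition smooth_funb n (M : manifold n) : {pred M -> R^o} :=
  [pred f | `[< smooth_fun f >]].

Lemma smooth_cst n (M : manifold n) a : smooth_fun (fun _ : M => a : R^o).
Proof. by move=> c _ k; exact: Ck_cst. Qed.

Lemma smoothD n (M : manifold n) (f g : M -> R^o) :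
  smooth_fun f -> smooth_fun g -> smooth_fun (f + g).
Proof. by move=> sf sg c ac k; apply: CkD; [exact: codom_open|exact: sf|exact: sg]. Qed.

Lemma smoothM n (M : manifold n) (f g : M -> R^o) :
  smooth_fun f -> smooth_fun g -> smooth_fun (f * g).
Proof. by move=> sf sg c ac k; apply: CkM; [exact: codom_open|exact: sf|exact: sg]. Qed.

Lemma smooth_subring n (M : manifold n) : subring_closed (@smooth_funb n M).
Proof.
split=> [|f g /asboolP sf /asboolP sg|f g /asboolP sf /asboolP sg]; apply/asboolP.
- exact: (@smooth_cst _ M 1).
- apply: smoothD => //; rewrite -mulN1r; apply: smoothM => //.
  exact: (@smooth_cst _ M (-1)).
- exact: smoothM.
Qed.

Lemma smooth_submod n (M : manifold n) : submod_closed (@smooth_funb n M).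
Proof.
split=> [|a f g /asboolP sf /asboolP sg]; apply/asboolP.
  exact: (@smooth_cst _ M 0).
by apply: smoothD => //; apply: (smoothM (@smooth_cst _ M a)).
Qed.

Record Cinf n (M : manifold n) := MkCinf {
  Cinf_fun :> M -> R^o;
  Cinf_smooth : Cinf_fun \in @smooth_funb n M }.

Section CinfTheory.
Variables (n : nat) (M : manifold n).
HB.instance Definition _ := [isSub for @Cinf_fun n M].
HB.instance Definition _ := [Choice of Cinf M by <:].
HB.instance Definition _ :=
  GRing.SubChoice_isSubComPzRing.Build _ _ (Cinf M) (@smooth_subring n M).
HB.instance Definition _ :=
  GRing.SubZmodule_isSubLmodule.Build R _ _ (Cinf M) (@smooth_submod n M).

Lemma CinfP (f g : Cinf M) : (forall p, f p = g p) -> f = g.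
Proof. by move=> fg; apply/val_inj/funext. Qed.

Lemma CinfD (f g : Cinf M) p : (f + g) p = f p + g p.
Proof. by []. Qed.

Lemma CinfN (f : Cinf M) p : (- f) p = - f p.
Proof. by []. Qed.

Lemma CinfM (f g : Cinf M) p : (f * g) p = f p * g p.
Proof. by []. Qed.

Lemma CinfZ a (f : Cinf M) p : (a *: f) p = a * f p.
Proof. by []. Qed.

Lemma Cinf0 p : (0 : Cinf M) p = 0.
Proof. by []. Qed.

Definition CinfE := (CinfD, CinfN, CinfM, CinfZ, Cinf0).

(* Tangent vectors at p are the derivations of C^oo(M) at p. *)
Definition is_derivation_at (p : M) (v : Cinf M -> R^o) : Prop :=
  linear v /\ forall f g : Cinf M, v (f * g) = v f * g p + f p * v g.

Definition is_derivation_atb (p : M) : {pred Cinf M -> R^o} :=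
  [pred v | `[< is_derivation_at p v >]].

Lemma derivation_at_submod p : submod_closed (is_derivation_atb p).
Proof.
split=> [|a v w /asboolP[lv dv] /asboolP[lw dw]]; apply/asboolP.
  by split=> [b f g|f g]; rewrite /= ?mulr0 ?mul0r ?scaler0 addr0.
split=> [b f g|f g]; rewrite /= !fctE.
  by rewrite lv lw /= /GRing.scale /=; ring.
by rewrite dv dw /= /GRing.scale /=; ring.
Qed.

Record tangent (p : M) := MkTangent {
  tangent_fun :> Cinf M -> R^o;
  tangent_derivation : tangent_fun \in is_derivation_atb p }.

Section Tangent.
Variable p : M.
HB.instance Definition _ := [isSub for @tangent_fun p].
HB.instance Definition _ := [Choice of tangent p by <:].
HB.instance Definition _ :=
  GRing.SubChoice_isSubLmodule.Build R _ _ (tangent p) (derivation_at_submod p).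
End Tangent.

(* Smooth vector fields are the R-linear derivations of C^oo(M): a smooth section
   X of TM corresponds to f |-> (p |-> X_p f), see [vfield_at]. They form a
   module over the ring C^oo(M). *)
Definition is_derivation (X : Cinf M -> (Cinf M)^o) : Prop :=
  linear (X : Cinf M -> Cinf M) /\
  forall f g : Cinf M, X (f * g) = X f * g + f * X g.

Definition is_derivationb : {pred Cinf M -> (Cinf M)^o} :=
  [pred X | `[< is_derivation X >]].

Lemma derivation_submod : submod_closed is_derivationb.
Proof.
split=> [|h X Y /asboolP[lX dX] /asboolP[lY dY]]; apply/asboolP.
  split=> [b f g|f g]; first by rewrite -[LHS]/(0 : Cinf M) scaler0 add0r.
  by rewrite -[LHS]/(0 : Cinf M) mul0r mulr0 add0r.
split=> [b f g|f g]; rewrite /= !fctE.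
  by rewrite lX lY; apply: CinfP => p; rewrite !CinfE; ring.
by rewrite dX dY; apply: CinfP => p; rewrite !CinfE; ring.
Qed.

Record vfield := MkVfield {
  vfield_fun :> Cinf M -> (Cinf M)^o;
  vfield_derivation : vfield_fun \in is_derivationb }.

HB.instance Definition _ := [isSub for vfield_fun].
HB.instance Definition _ := [Choice of vfield by <:].
HB.instance Definition _ :=
  GRing.SubChoice_isSubLmodule.Build (Cinf M) _ _ vfield derivation_submod.

End CinfTheory.

Section VectorFields.
Context {n : nat} {M : manifold n}.

Lemma vfield_at_subproof (X : vfield M) p :
  (fun f : Cinf M => X f p : R^o) \in is_derivation_atb p.
Proof.
have /asboolP[lX dX] := vfield_derivation X.
by apply/asboolP; split=> [a f g|f g]; rewrite ?lX ?dX.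
Qed.

Definition vfield_at (X : vfield M) (p : M) : tangent p :=
  MkTangent (vfield_at_subproof X p).

Lemma bracket_subproof (X Y : vfield M) :
  (fun f : Cinf M => X (Y f) - Y (X f) : (Cinf M)^o) \in @is_derivationb n M.
Proof.
have /asboolP[lX dX] := vfield_derivation X.
have /asboolP[lY dY] := vfield_derivation Y.
have XD f g : X (f + g) = X f + X g by have := lX 1 f g; rewrite !scale1r.
have YD f g : Y (f + g) = Y f + Y g by have := lY 1 f g; rewrite !scale1r.
apply/asboolP; split=> [a f g|f g].
  by rewrite /= !(lX, lY); apply: CinfP => p; rewrite !CinfE; ring.
by rewrite /= dX dY XD YD !dX !dY; ring.
Qed.

Definition bracket (X Y : vfield M) : vfield M :=
  MkVfield (bracket_subproof X Y).
End VectorFields.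

Section Riemannian.
Context {n : nat} (M : manifold n).

Record metric := Metric {
  inner : forall p : M, tangent p -> tangent p -> R^o;
  innerC : forall p (u v : tangent p), inner u v = inner v u;
  inner_linear : forall p (u : tangent p), linear (inner u);
  inner_gt0 : forall p (v : tangent p), v != 0 -> 0 < inner v v;
  inner_smooth : forall X Y : vfield M,
    (fun p => inner (vfield_at X p) (vfield_at Y p)) \in @smooth_funb n M }.

Definition vinner (k : metric) (X Y : vfield M) : Cinf M :=
  MkCinf (inner_smooth k X Y).

Record connection := Connection {
  nabla :> vfield M -> vfield M -> vfield M;
  nabla_tensor : forall (f : Cinf M) X Y Z,
    nabla (f *: X + Y) Z = f *: nabla X Z + nabla Y Z;
  nablaD : forall X Y Z, nabla X (Y + Z) = nabla X Y + nabla X Z;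
  nabla_leibniz : forall (X : vfield M) (f : Cinf M) Y,
    nabla X (f *: Y) = X f *: Y + f *: nabla X Y }.

Definition levi_civita (k : metric) (D : connection) : Prop :=
  (forall X Y, D X Y - D Y X = bracket X Y) /\
  (forall X Y Z : vfield M, X (vinner k Y Z) = vinner k (D X Y) Z + vinner k Y (D X Z)).
End Riemannian.

Section SmoothMaps.
Context {n m : nat} (P : manifold n) (M : manifold m).

Record smooth_map := SmoothMap {
  smap :> P -> M;
  smap_continuous : continuous smap;
  smap_smooth : forall c c', atlas c -> atlas c' ->
    smooth_map_on (coord c @` (dom c `&` smap @^-1` dom c'))
      (coord c' \o smap \o icoord c) }.

Lemma smooth_pullback (pi : smooth_map) (f : Cinf M) :
  (fun p => f (pi p) : R^o) \in @smooth_funb n P.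
Proof.
apply/asboolP => c ac k; apply: Ck_local => x [p dp <-].
have [c' ac' dc'] := atlas_cover (pi p).
set V := coord c @` (dom c `&` pi @^-1` dom c').
have cK q : dom c q -> icoord c (coord c q) = q.
  by move=> dq; apply: coordK; rewrite inE.
exists V; first by exists p.
have VE : V = codom c `&` icoord c @^-1` (pi @^-1` dom c').
  apply/seteqP; split=> [_ [q [dq pq] <-]|_ [[q dq <-]]] /=.
    by split; [exists q|rewrite cK].
  by rewrite cK => // pq; exists q.
have oV : open V.
  rewrite openE VE => y [cy py].
  apply: filterI; first by apply: open_nbhs_nbhs; split=> //; exact: codom_open.
  have /(_ y) ic := @icoord_continuous _ _ c.
  apply: ic; first by rewrite inE.
  apply: open_nbhs_nbhs; split=> //.
  by apply: open_comp (dom_open c') => ? _; exact: smap_continuous.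
have sf : smooth_fun f by have /asboolP := Cinf_smooth f.
apply: (Ck_eq oV); last first.
  apply: (Ck_comp oV _ _ (sf c' ac' k)); last first.
    by move=> j; exact: (smap_smooth pi ac ac').
  move=> y; rewrite VE => -[_ py] /=.
  by exists (pi (icoord c y)).
move=> y; rewrite VE => -[_ py] /=.
by rewrite coordK ?inE.
Qed.

Definition pullback (pi : smooth_map) (f : Cinf M) : Cinf P :=
  MkCinf (smooth_pullback pi f).

Lemma differential_subproof (pi : smooth_map) p (v : tangent p) :
  (fun f => v (pullback pi f)) \in is_derivation_atb (pi p).
Proof.
have /asboolP[lv dv] := tangent_derivation v.
apply/asboolP; split=> [a f g|f g].
  by rewrite -lv; congr (v _); apply: CinfP.
by rewrite -[f (pi p)]/(pullback pi f p) -[g (pi p)]/(pullback pi g p) -dv;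
   congr (v _); apply: CinfP.
Qed.

Definition differential (pi : smooth_map) p (v : tangent p) : tangent (pi p) :=
  MkTangent (differential_subproof pi v).

Definition submersion (pi : smooth_map) : Prop :=
  forall p (w : tangent (pi p)), exists v, differential pi v = w.

Definition vertical_at (pi : smooth_map) (p : P) (v : tangent p) : Prop :=
  differential pi v = 0.

Definition horizontal_at (k : metric P) (pi : smooth_map) (p : P)
    (v : tangent p) : Prop :=
  forall u : tangent p, vertical_at pi u -> inner k v u = 0.

Definition vertical (pi : smooth_map) (X : vfield P) : Prop :=
  forall p, vertical_at pi (vfield_at X p).

Definition horizontal (k : metric P) (pi : smooth_map) (X : vfield P) : Prop :=
  forall p, horizontal_at k pi (vfield_at X p).

(* The orthogonal projection TP -> V along H, as a smooth bundle map; its first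
   two fields determine it fibrewise. *)
Record vertical_projection (k : metric P) (pi : smooth_map) :=
  VerticalProjection {
    vproj : forall p : P, tangent p -> tangent p;
    vproj_vertical : forall p (v : tangent p), vertical_at pi (vproj v);
    vproj_orthogonal : forall p (v : tangent p),
      horizontal_at k pi (v - vproj v);
    vproj_smooth : forall (X : vfield P) (f : Cinf P),
      (fun p => vproj (vfield_at X p) f) \in @smooth_funb n P }.

Lemma vprojf_subproof k pi (theta : vertical_projection k pi) (X : vfield P) :
  (fun f => MkCinf (vproj_smooth theta X f) : (Cinf P)^o)
    \in @is_derivationb n P.
Proof.
apply/asboolP; split=> [a f g|f g]; apply: CinfP => p; rewrite ?CinfE /=;
  have /asboolP[lv dv] := tangent_derivation (vproj theta (vfield_at X p)).
  exact: lv.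
exact: dv.
Qed.

(* The map induced by the projection on vector fields. *)
Definition vprojf k pi (theta : vertical_projection k pi) (X : vfield P) :
    vfield P :=
  MkVfield (vprojf_subproof theta X).

End SmoothMaps.

Section CurvatureForm.
Context {n m : nat} {P : manifold n} {M : manifold m}.
Variables (k : metric P) (pi : smooth_map P M).
Variables (D : connection P) (vp : vertical_projection k pi).
Local Notation theta := (vprojf vp).

Definition nabla_v (A V : vfield P) : vfield P := theta (D A V).

Definition curvature_form (A B : vfield P) : vfield P :=
  nabla_v A (theta B) - nabla_v B (theta A) - theta (bracket A B).

Definition flat : Prop := forall A B, curvature_form A B = 0.

(* The collective shape operator A_H V, for V vertical and H horizontal. With
   this sign, and since the torsion vanishes,
     Theta(V, H) = - theta (nabla_H V) - theta [V, H]
                 = - theta (nabla_V H) = A_H V,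
   equivalently Theta(H, V) = - A_H V. *)
Definition shape_operator (H V : vfield P) : vfield P := - theta (D V H).

(* The horizontal component of nabla_V W. For V and W vertical, its value at p is
   the second fundamental form of the fibre through p at (V_p, W_p): that form
   is tensorial and may be computed with any extensions of V_p and W_p tangent
   to the fibre, and the tangent space of the fibre at p is ker (d pi)_p. *)
Definition second_fundamental_form (V W : vfield P) : vfield P :=
  D V W - theta (D V W).

Definition totally_geodesic_fibre (x : M) : Prop :=
  forall V W, vertical pi V -> vertical pi W ->
  forall p, pi p = x -> vfield_at (second_fundamental_form V W) p = 0.

Definition totally_geodesic_fibres : Prop :=
  forall x, totally_geodesic_fibre x.

(* Integrability of a distribution in the sense of closure of its sections under
   the Lie bracket. *)
Definition integrable_horizontal : Prop :=
  forall H K, horizontal k pi H -> horizontal k pi K ->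
  horizontal k pi (bracket H K).

End CurvatureForm.
End Manifold.

(* Main.v *)
Require Import Defs.
From mathcomp Require Import all_boot all_order all_algebra.
From mathcomp Require Import boolp reals topology.

Set Implicit Arguments.
Unset Strict Implicit.
Unset Printing Implicit Defensive.

Import Order.Theory GRing.Theory.
Local Open Scope ring_scope.

(** Write hX for the horizontal part X - theta X.  Eliminating the bracket with
    the vanishing torsion gives
      Theta(A, B) = theta (nabla_B hA - nabla_A hB),
    from which (i)-(iii) are immediate.  For V, W vertical and H horizontal,
    differentiating <H, W> = 0 along V gives <nabla_V H, W> = - <H, nabla_V W>,
    so theta (nabla_V H) = 0 for all such V, H iff the fibres are totally
    geodesic; splitting A and B into their vertical and horizontal parts then
    characterizes flatness. *)

(** * Pointwise calculus of vector fields *)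

Lemma vfieldP (R : realType) (n : nat) (P : manifold (R := R) n)
    (X Y : vfield P) :
  (forall p, vfield_at X p = vfield_at Y p) -> X = Y.
Proof.
move=> XY; apply/val_inj/funext => f; apply: CinfP => p.
by have := congr1 (fun v : tangent p => v f) (XY p).
Qed.

Lemma vfield_atD (R : realType) (n : nat) (P : manifold (R := R) n)
    (X Y : vfield P) p : vfield_at (X + Y) p = vfield_at X p + vfield_at Y p.
Proof. exact: val_inj. Qed.

Lemma vfield_atN (R : realType) (n : nat) (P : manifold (R := R) n)
    (X : vfield P) p : vfield_at (- X) p = - vfield_at X p.
Proof. exact: val_inj. Qed.

Lemma vfield_at0 (R : realType) (n : nat) (P : manifold (R := R) n) (p : P) :
  vfield_at 0 p = 0.
Proof. exact: val_inj. Qed.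

(** * Bilinearity and definiteness of the metric *)

Section Metric.
Variables (R : realType) (n : nat) (P : manifold (R := R) n) (k : metric P).

Lemma innerDr p (u v w : tangent p) :
  inner k u (v + w) = inner k u v + inner k u w.
Proof. by have := inner_linear k u 1 v w; rewrite !scale1r. Qed.

Lemma innerNr p (u v : tangent p) : inner k u (- v) = - inner k u v.
Proof.
apply: (addrI (inner k u v)); rewrite -innerDr !subrr.
by apply: (addrI (inner k u 0)); rewrite -innerDr !addr0.
Qed.

Lemma innerDl p (u v w : tangent p) :
  inner k (u + v) w = inner k u w + inner k v w.
Proof. by rewrite !(innerC _ _ w) innerDr. Qed.

Lemma innerNl p (u v : tangent p) : inner k (- u) v = - inner k u v.
Proof. by rewrite !(innerC _ _ v) innerNr. Qed.

Lemma inner_eq0 p (v : tangent p) : inner k v v = 0 -> v = 0.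
Proof.
move=> v0; apply/eqP/negPn/negP => /(inner_gt0 k).
by rewrite v0 ltxx.
Qed.

Lemma vinner_eq0 (X : vfield P) : vinner k X X = 0 -> X = 0.
Proof.
move=> X0; apply: vfieldP => p; rewrite vfield_at0; apply: inner_eq0.
by have := congr1 (fun f : Cinf P => f p) X0.
Qed.

Lemma vinnerDr (X Y Z : vfield P) :
  vinner k X (Y + Z) = vinner k X Y + vinner k X Z.
Proof. by apply: CinfP => p; rewrite CinfE /= vfield_atD innerDr. Qed.

Lemma vinnerC (X Y : vfield P) : vinner k X Y = vinner k Y X.
Proof. by apply: CinfP => p; exact: innerC. Qed.

End Metric.

(** * Additivity of the connection *)

Section Connection.
Variables (R : realType) (n : nat) (P : manifold (R := R) n) (D : connection P).

Lemma nablaDl X Y Z : D (X + Y) Z = D X Z + D Y Z.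
Proof. by have := nabla_tensor D 1 X Y Z; rewrite !scale1r. Qed.

Lemma nabla0 X : D X 0 = 0.
Proof. by apply: (addrI (D X 0)); rewrite -nablaD !addr0. Qed.

Lemma nablaN X Y : D X (- Y) = - D X Y.
Proof. by apply: (addrI (D X Y)); rewrite -nablaD !subrr nabla0. Qed.

Lemma nablaB X Y Z : D X (Y - Z) = D X Y - D X Z.
Proof. by rewrite nablaD nablaN. Qed.

End Connection.

(** * Vertical and horizontal fields and the projection between them *)

Section Splitting.
Variables (R : realType) (n m : nat).
Variables (P : manifold (R := R) n) (M : manifold (R := R) m).
Variables (k : metric P) (pi : smooth_map P M).

Lemma vertical0 : vertical pi 0.
Proof. by move=> p; exact: val_inj. Qed.

Lemma verticalD X Y : vertical pi X -> vertical pi Y -> vertical pi (X + Y).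
Proof.
move=> vX vY p; rewrite /vertical_at vfield_atD.
transitivity
  (differential pi (vfield_at X p) + differential pi (vfield_at Y p)).
  exact: val_inj.
by rewrite vX vY addr0.
Qed.

Lemma verticalN X : vertical pi X -> vertical pi (- X).
Proof.
move=> vX p; rewrite /vertical_at vfield_atN.
transitivity (- differential pi (vfield_at X p)); first exact: val_inj.
by rewrite vX oppr0.
Qed.

Lemma horizontalD X Y :
  horizontal k pi X -> horizontal k pi Y -> horizontal k pi (X + Y).
Proof.
by move=> hX hY p u vu; rewrite vfield_atD innerDl hX // hY // addr0.
Qed.

Lemma horizontalN X : horizontal k pi X -> horizontal k pi (- X).
Proof. by move=> hX p u vu; rewrite vfield_atN innerNl hX // oppr0. Qed.

Lemma horizontal_vinner H V :
  horizontal k pi H -> vertical pi V -> vinner k H V = 0.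
Proof. by move=> hH vV; apply: CinfP => p; exact/hH/vV. Qed.

(** Such a field is orthogonal to itself, so definiteness applies. *)
Lemma vertical_horizontal0 X : vertical pi X -> horizontal k pi X -> X = 0.
Proof.
move=> vX hX; apply: (@vinner_eq0 _ _ _ k).
exact: horizontal_vinner.
Qed.

Variable vp : vertical_projection k pi.
Local Notation theta := (vprojf vp).

Lemma vfield_at_vprojf X p : vfield_at (theta X) p = vproj vp (vfield_at X p).
Proof. exact: val_inj. Qed.

Lemma vprojf_vertical X : vertical pi (theta X).
Proof. by move=> p; rewrite vfield_at_vprojf; exact: vproj_vertical. Qed.

Lemma vprojf_horizontal X : horizontal k pi (X - theta X).
Proof.
move=> p; rewrite vfield_atD vfield_atN vfield_at_vprojf.
exact: vproj_orthogonal.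
Qed.

(** The difference [theta X - Y] is both vertical and horizontal. Additivity of [theta], which is
    not a field of [vertical_projection], is derived from this. *)
Lemma vprojf_unique X Y :
  vertical pi Y -> horizontal k pi (X - Y) -> theta X = Y.
Proof.
move=> vY hXY; apply/subr0_eq/vertical_horizontal0.
  by apply: verticalD; [exact: vprojf_vertical|exact: verticalN].
rewrite (_ : theta X - Y = - (X - theta X) + (X - Y)).
  by apply: horizontalD => //; exact/horizontalN/vprojf_horizontal.
by rewrite opprB addrA subrK.
Qed.

Lemma vprojf_id V : vertical pi V -> theta V = V.
Proof.
move=> vV; apply: vprojf_unique => // p u _.
by rewrite subrr -(subrr V) vfield_atD vfield_atN innerDl innerNl subrr.
Qed.

Lemma vprojf_eq0 H : theta H = 0 <-> horizontal k pi H.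
Proof.
split=> [H0|hH]; first by rewrite -[H]subr0 -H0; exact: vprojf_horizontal.
by apply: vprojf_unique; [exact: vertical0|rewrite subr0].
Qed.

Lemma vprojfD X Y : theta (X + Y) = theta X + theta Y.
Proof.
apply: vprojf_unique; first by apply: verticalD; exact: vprojf_vertical.
by rewrite opprD addrACA; apply: horizontalD; exact: vprojf_horizontal.
Qed.

Lemma vprojfN X : theta (- X) = - theta X.
Proof.
apply: vprojf_unique; first exact/verticalN/vprojf_vertical.
by rewrite -opprD; exact/horizontalN/vprojf_horizontal.
Qed.

Lemma vprojfB X Y : theta (X - Y) = theta X - theta Y.
Proof. by rewrite vprojfD vprojfN. Qed.

(** * Curvature form, shape operator and second fundamental form *)

Variable D : connection P.
Hypothesis D_LC : levi_civita k D.

Lemma curvature_formE A B :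
  curvature_form D vp A B = theta (D B (A - theta A) - D A (B - theta B)).
Proof.
rewrite /curvature_form /nabla_v -D_LC.1 -!vprojfB !nablaB; congr (theta _).
by rewrite !opprB addrACA [X in X + _]addrC [RHS]addrACA.
Qed.

Lemma vinner_nabla_orthogonal V H W : horizontal k pi H -> vertical pi W ->
  vinner k (D V H) W + vinner k H (D V W) = 0.
Proof.
move=> hH vW; rewrite -D_LC.2 horizontal_vinner //.
have /asboolP[lV _] := vfield_derivation V.
(* Linearity at [-1], [0], [0] reads [V 0 = - V 0 + V 0], hence [V 0 = 0]. *)
by have := lV (-1) 0 0; rewrite scaler0 addr0 scaleN1r addNr.
Qed.

(** Every [p] lies in the fibre over [pi p], so the fibrewise conditions together cover all of
    [P]. *)
Lemma totally_geodesic_fibresE :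
  totally_geodesic_fibres D vp <->
  (forall V W, vertical pi V -> vertical pi W ->
    second_fundamental_form D vp V W = 0).
Proof.
split=> [tg V W vV vW|II0 x V W vV vW p _]; last by rewrite II0 // vfield_at0.
by apply: vfieldP => p; rewrite (tg (pi p)) // vfield_at0.
Qed.

(** For fixed [V], the two off-diagonal components of [D V] with respect to the splitting are
    negative adjoints of each other. Each direction pairs the component to be killed with itself. *)
Lemma shape_second_fundamental V :
  (forall H, horizontal k pi H -> theta (D V H) = 0) <->
  (forall W, vertical pi W -> second_fundamental_form D vp V W = 0).
Proof.
have splitD X : X = (X - theta X) + theta X by rewrite subrK.
split=> [S0 W vW|II0 H hH]; apply: (@vinner_eq0 _ _ _ k).
(* With [H] the horizontal part of [D V W], the pairing of [H] with [D V W] is that of [H] with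
   itself; it vanishes because [D V H] is horizontal. *)
- rewrite /second_fundamental_form; set H := (_ - _).
  have hH : horizontal k pi H by exact: vprojf_horizontal.
  have := vinner_nabla_orthogonal V hH vW.
  rewrite horizontal_vinner //; last exact/vprojf_eq0/S0.
  rewrite add0r [D V W]splitD vinnerDr -/H.
  rewrite [X in _ + X]horizontal_vinner ?addr0 //.
  exact: vprojf_vertical.
(* Dually, [W] is the vertical part of [D V H], and [D V W] is vertical by [II0]. *)
- set W := theta _.
  have vW : vertical pi W by exact: vprojf_vertical.
  have := vinner_nabla_orthogonal V hH vW.
  rewrite [X in _ + X]horizontal_vinner //; last first.
    by rewrite (subr0_eq (II0 W vW)); exact: vprojf_vertical.
  rewrite addr0 [D V H]splitD vinnerC vinnerDr -/W [X in X + _]vinnerC.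
  rewrite [X in X + _]horizontal_vinner ?add0r //; exact: vprojf_horizontal.
Qed.

Lemma curvature_form_vertical V W : vertical pi V -> vertical pi W ->
  curvature_form D vp V W = 0.
Proof.
move=> vV vW; rewrite curvature_formE (vprojf_id vV) (vprojf_id vW).
by rewrite !subrr !nabla0 subrr vprojf_id //; exact: vertical0.
Qed.

(** Only [- theta (D V H)] survives in [curvature_formE]; this is [shape_operator] itself, with a
    plus sign. *)
Lemma curvature_form_mixed V H : vertical pi V -> horizontal k pi H ->
  curvature_form D vp V H = shape_operator D vp H V.
Proof.
move=> vV /vprojf_eq0 hH.
by rewrite curvature_formE (vprojf_id vV) hH subrr subr0 nabla0 sub0r vprojfN.
Qed.

Lemma curvature_form_horizontal H K :
  horizontal k pi H -> horizontal k pi K ->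
  curvature_form D vp H K = - theta (bracket H K).
Proof.
move=> /vprojf_eq0 hH /vprojf_eq0 hK.
by rewrite curvature_formE hH hK !subr0 -D_LC.1 -vprojfN opprB.
Qed.

Lemma flat_iff_geodesic_integrable :
  flat D vp <-> totally_geodesic_fibres D vp /\ integrable_horizontal k pi.
Proof.
split=> [fl|[/totally_geodesic_fibresE tg int] A B].
  split.
    apply/totally_geodesic_fibresE => V W vV; move: W.
    apply/shape_second_fundamental => H hH; apply: oppr_inj.
    by rewrite oppr0 -(fl V H) curvature_form_mixed.
  move=> H K hH hK; apply/vprojf_eq0/oppr_inj.
  by rewrite oppr0 -(fl H K) curvature_form_horizontal.
(* Totally geodesic fibres make the shape operator vanish along the vertical field [theta X]. *)
have S0 X Y : theta (D (theta X) (Y - theta Y)) = 0.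
  move: (Y - theta Y) (vprojf_horizontal Y).
  apply/shape_second_fundamental => W.
  exact/tg/vprojf_vertical.
(* Hence only the horizontal part of the direction of differentiation matters. *)
have DE X Y : theta (D X (Y - theta Y)) = theta (D (X - theta X) (Y - theta Y)).
  by rewrite -{1}[X](subrK (theta X)) [in LHS]nablaDl vprojfD S0 addr0.
(* By zero torsion, what remains is [theta] of the bracket of the horizontal parts of [B] and [A],
   which integrability makes zero. *)
rewrite curvature_formE vprojfB (DE A B) (DE B A) -vprojfB D_LC.1.
by apply/vprojf_eq0/int; exact: vprojf_horizontal.
Qed.

End Splitting.

Theorem proposition3p5 (R : realType) (n m : nat)
    (P : manifold (R := R) n) (M : manifold (R := R) m)
    (k : metric P) (g : metric M)
    (pi : smooth_map P M) (pi_submersion : submersion pi)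
    (nabla : connection P) (nabla_LC : levi_civita k nabla)
    (theta : vertical_projection k pi) :
  (forall V W H K : vfield P,
     vertical pi V -> vertical pi W -> horizontal k pi H -> horizontal k pi K ->
     [/\ curvature_form nabla theta V W = 0,
         curvature_form nabla theta V H = shape_operator nabla theta H V &
         curvature_form nabla theta H K = - vprojf theta (bracket H K)]) /\
  (flat nabla theta <->
     totally_geodesic_fibres nabla theta /\ integrable_horizontal k pi).
Proof.
split=> [V W H K vV vW hH hK|]; last exact: flat_iff_geodesic_integrable.
split; [exact: curvature_form_vertical|exact: curvature_form_mixed|].
exact: curvature_form_horizontal.
Qed.
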